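(* Let $m\geq 1$ be an integer. (1) A primitive $2^m$-th root of unity $\zeta_{2^m}$ lies in $K_\infty$, and it is equal to a product of expressions of the form $\beta-1$ and $(\beta'-1)^{-1}$ for some vertices $\beta,\beta'$ of the preimage tree (elements of $\bigcup_{n\geq 0} f^{-n}(t)$). (2) Moreover, $K_n$ contains $\zeta_{2^m}$ for $n=2m-1$.
   Context: $k$ is a number field, $f(x)=\frac{1}{(x-1)^2}$, $t$ transcendental over $k$, $K=k(t)$; $K_n$ is the splitting field over $K$ of $f^n(x)-t$ (i.e. of $g_n(x)-th_n(x)$ with $f^n=g_n/h_n$ in lowest terms), and $K_\infty=\bigcup_n K_n$. *)

(* Defs.v *)
From HB Require Import structures.
From mathcomp Require Import all_boot all_order all_algebra all_field.
Set Implicit Arguments.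
Unset Strict Implicit.
Unset Printing Implicit Defensive.
Import GRing.Theory.
Local Open Scope ring_scope.
Local Open Scope quotient_scope.

(* At the pole x = 1 this returns 0 rather than infinity. *)
Definition quad_map (F : fieldType) (x : F) : F := 1 / (x - 1) ^+ 2.

Section ReducedFraction.
Variable k : fieldType.
Implicit Type r : {fraction {poly k}}.

(* [\n_] and [\d_] of a representative need not be coprime. *)
Definition red_num r : {poly k} :=
  \n_(repr r) %/ gcdp \n_(repr r) \d_(repr r).
Definition red_den r : {poly k} :=
  \d_(repr r) %/ gcdp \n_(repr r) \d_(repr r).

Lemma coprimep_red r : coprimep (red_num r) (red_den r).
Proof.
by rewrite /red_num /red_den coprimep_div_gcd // denom_ratioP orbT.
Qed.

Lemma red_den_neq0 r : red_den r != 0.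
Proof. by rewrite dvdp_div_eq0 ?dvdp_gcdr // denom_ratioP. Qed.

Lemma fracE r : r = FracField.tofrac (red_num r) / FracField.tofrac (red_den r).
Proof.
set n := \n_(repr r); set d := \d_(repr r).
have dn0 : d != 0 by rewrite denom_ratioP.
have g0 : gcdp n d != 0 by rewrite gcdp_eq0 (negPf dn0) andbF.
have rE : r * FracField.tofrac d = FracField.tofrac n.
  rewrite -[r in LHS]reprK; apply/eqP; rewrite !piE.
  rewrite /FracField.equivf /FracField.mulf.
  by rewrite !numden_Ratio ?mulr1 ?oner_neq0 // mulrC.
apply: (canRL (mulfK _)); first by rewrite tofrac_eq0 red_den_neq0.
apply: (@mulIf _ (FracField.tofrac (gcdp n d))); first by rewrite tofrac_eq0.
by rewrite -mulrA -!tofracM /red_num /red_den !divpK ?dvdp_gcdl ?dvdp_gcdr.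
Qed.

(* The rational function f^n(x) in k(x), obtained by iterating from the generic
   point x; no iterate is the constant 1, so the pole is never met. *)
Definition iter_frac (n : nat) : {fraction {poly k}} :=
  iter n (@quad_map {fraction {poly k}}) (FracField.tofrac 'X).

End ReducedFraction.

Inductive gen_subfield (L : fieldType) (S : L -> Prop) : L -> Prop :=
| gen_base x : S x -> gen_subfield S x
| gen_one : gen_subfield S 1
| gen_sub x y : gen_subfield S x -> gen_subfield S y -> gen_subfield S (x - y)
| gen_div x y : gen_subfield S x -> gen_subfield S y -> gen_subfield S (x / y).

Section Tower.
Variables (k : fieldType) (Omega : closedFieldType).
Variables (iota : {rmorphism k -> Omega}) (t : Omega).

Definition base_field : Omega -> Prop :=
  gen_subfield (fun x => (exists a, x = iota a) \/ x = t).

Definition level_poly (n : nat) : {poly Omega} :=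
  map_poly iota (red_num (iter_frac k n))
  - t *: map_poly iota (red_den (iter_frac k n)).

Definition splitting_level (n : nat) : Omega -> Prop :=
  gen_subfield (fun x => base_field x \/ root (level_poly n) x).

Definition splitting_union (x : Omega) : Prop :=
  exists n, splitting_level n x.

(* For t transcendental this agrees with the preimages of t in P^1: infinity is
   not a preimage of t, and neither is 1, as the orbit of 1, whether under f
   (1, oo, 0, 1, ...) or under [quad_map] (1, 0, 1, ...), avoids t. *)
Definition tree_vertex (b : Omega) : Prop :=
  exists n, iter n (@quad_map Omega) b = t.

End Tower.

(* Main.v *)
(** If [c] and [c' = 2 - c] are the preimages of a vertex [b], then
    [c c' = 1 - (c - 1)^2 = (b - 1) / b], while every vertex is the square of
    [(d - 1)^-1] for each of its preimages [d].  Hence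
    [b - 1 = b c c' = ((c - 1) (e - 1) (e' - 1))^-2] with [e], [e'] preimages of
    [c], [c']: each [b - 1] has a square root that is a product of inverses of
    such differences at most two levels further up.  Starting from
    [-1 = (c - 1) / (c' - 1)] at level 1, each extraction of a square root
    climbs two levels. *)
Require Import Defs.
From HB Require Import structures.
From mathcomp Require Import all_boot all_order all_algebra all_field.
From mathcomp Require Import ring.
Set Implicit Arguments.
Unset Strict Implicit.
Unset Printing Implicit Defensive.
Import GRing.Theory.
Local Open Scope ring_scope.

(** * Closure properties of generated subfields *)

Section GenSubfield.
Variables (L : fieldType) (S : L -> Prop).

Lemma gen_subfieldM x y :
  gen_subfield S x -> gen_subfield S y -> gen_subfield S (x * y).
Proof.
move=> Sx Sy; rewrite -[y]invrK -[y^-1]mul1r.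
by apply: gen_div => //; apply: gen_div => //; apply: gen_one.
Qed.

Lemma gen_subfieldV x : gen_subfield S x -> gen_subfield S x^-1.
Proof. by move=> Sx; rewrite -[x^-1]mul1r; apply: gen_div => //; apply: gen_one. Qed.

Lemma gen_subfield_prod (s : seq L) (F : L -> L) :
  (forall x, x \in s -> gen_subfield S (F x)) ->
  gen_subfield S (\prod_(x <- s) F x).
Proof.
move=> SF; rewrite big_seq.
by apply: big_ind => //; [apply: gen_one | apply: gen_subfieldM].
Qed.

Lemma gen_subfield_iter_quad_map n x :
  gen_subfield S x -> gen_subfield S (iter n (@quad_map L) x).
Proof.
move=> Sx; elim: n => //= n Sy; rewrite /quad_map.
have Sy1 : gen_subfield S (iter n (@quad_map L) x - 1).
  by apply: gen_sub => //; apply: gen_one.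
by apply: gen_div; [apply: gen_one | apply: gen_subfieldM].
Qed.

End GenSubfield.

(** At the pole the convention 1/0 = 0 makes the value 0, so a nonzero value rules out [c = 1]. *)
Lemma quad_map_neq0 (F : fieldType) (c : F) : quad_map c != 0 -> c - 1 != 0.
Proof. by apply: contraNneq => c1; rewrite /quad_map c1 expr0n /= invr0 mulr0. Qed.

Lemma quad_map_frac (F : fieldType) (p q : F) :
  q != 0 -> p - q != 0 -> quad_map (p / q) = q ^+ 2 / (p - q) ^+ 2.
Proof. by move=> q0 pq0; rewrite /quad_map; field; rewrite q0 pq0. Qed.

(** * Evaluating the formal iterates of f at a point *)

Section IterFrac.
Variables (k F : fieldType) (iota : {rmorphism k -> F}).

(** The pair [(p, q)] follows the recursion [(p, q) -> (q^2, (p - q)^2)]; coprimality is not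
    tracked. At [b] the difference [p - q] equals [(y - 1) q] with [y] the current iterate, so an
    orbit that avoids the pole 1 keeps every denominator nonzero. *)
Lemma iter_frac_eval n (b : F) :
    (forall i, (i < n)%N -> iter i (@quad_map F) b != 1) ->
  exists p q : {poly k},
    [/\ iter_frac k n = FracField.tofrac p / FracField.tofrac q,
        (map_poly iota q).[b] != 0
      & (map_poly iota p).[b] = iter n (@quad_map F) b * (map_poly iota q).[b]].
Proof.
elim: n => [|n IHn] b_neq1.
  exists 'X, 1; rewrite rmorph1 invr1 mulr1; split=> //.
    by rewrite rmorph1 hornerC oner_eq0.
  by rewrite map_polyX rmorph1 hornerX hornerC mulr1.
have [i lt_in|p [q [fE qb0 pbE]]] := IHn; first by apply/b_neq1/ltnW.
set y := iter n (@quad_map F) b in pbE.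
have y1 : y - 1 != 0 by rewrite subr_eq0 b_neq1.
have pqb : (map_poly iota (p - q)).[b] = (y - 1) * (map_poly iota q).[b].
  by rewrite rmorphB hornerD hornerN pbE mulrBl mul1r.
have pqb0 : (map_poly iota (p - q)).[b] != 0 by rewrite pqb mulf_neq0.
have q0 : q != 0 by apply: contraNneq qb0 => ->; rewrite rmorph0 horner0.
have pq0 : p - q != 0 by apply: contraNneq pqb0 => ->; rewrite rmorph0 horner0.
exists (q ^+ 2), ((p - q) ^+ 2); split.
- rewrite /iter_frac iterS -/(iter_frac k n) fE quad_map_frac ?tofrac_eq0 //.
    by rewrite -tofracB !tofracXn.
  by rewrite -tofracB tofrac_eq0.
- by rewrite rmorphXn horner_exp expf_neq0.
rewrite iterS -/y !rmorphXn !horner_exp pqb /quad_map.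
by field.
Qed.

End IterFrac.

(** * The preimage tree of [t] and the fields K_n *)

Section Tree.
Variables (k : fieldType) (Omega : closedFieldType).
Variables (iota : {rmorphism k -> Omega}) (t : Omega).
Hypothesis t_transc : ~ algebraicOver iota t.

Let f := @quad_map Omega.

(** With 1/0 = 0, [quad_map] swaps 0 and 1, so an orbit that starts at either one could only reach
    [t] if [t] were 0 or 1, hence algebraic over [k]. *)
Lemma iter_quad_map_neq n (b : Omega) : iter n f b = t -> b != 0 /\ b != 1.
Proof.
have f0 : f 0 = 1 by rewrite /f /quad_map sub0r sqrrN expr1n divr1.
have f1 : f 1 = 0 by rewrite /f /quad_map subrr expr0n /= invr0 mulr0.
have orbit01 x : x = 0 \/ x = 1 -> iter n f x = 0 \/ iter n f x = 1.
  by elim: n => //= n IHn /IHn[] ->; [right | left].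
have t01 : ~ (t = 0 \/ t = 1).
  case=> tE; apply: t_transc.
    by rewrite tE -(rmorph0 iota); apply: algebraic_id.
  by rewrite tE -(rmorph1 iota); apply: algebraic_id.
by move=> bt; split; apply/eqP => b01; apply: t01; rewrite -bt; apply: orbit01; auto.
Qed.

Lemma exists_quad_map (b : Omega) : b != 0 -> exists c, quad_map c = b.
Proof.
(* The monic equation being solved is [r^2 = b^-1]; the preimage is then [r + 1]. *)
move=> b0; have [//|r] := @solve_monicpoly Omega 2 (fun i => if i == 0%N then b^-1 else 0).
rewrite !big_ord_recl big_ord0 /= mul0r expr0 mulr1 !addr0 => rE.
by exists (r + 1); rewrite /quad_map addrK rE div1r invrK.
Qed.

Lemma root_level_poly n b : iter n f b = t -> root (level_poly iota t n) b.
Proof.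
move=> bt.
have [|p [q [fE qb0 pbE]]] := @iter_frac_eval _ _ iota n b.
  (* Each earlier iterate of [b] is itself a vertex, hence differs from 1. *)
  move=> i lt_in; rewrite -(subnK (ltnW lt_in)) iterD in bt.
  by case: (iter_quad_map_neq bt).
have q0 : q != 0 by apply: contraNneq qb0 => ->; rewrite rmorph0 horner0.
(* The lowest-terms form and [p / q] agree in k(x); cross-multiplying gives a polynomial identity,
   to be evaluated at [b], where [q] does not vanish. *)
have numE : red_num (iter_frac k n) * q = p * red_den (iter_frac k n).
  apply/eqP; rewrite -(tofrac_eq (_ * _)) !tofracM -eqr_div ?tofrac_eq0 ?red_den_neq0 //.
  by rewrite -fracE fE.
rewrite /root /level_poly hornerD hornerN hornerZ subr_eq0.
apply/eqP/(mulIf qb0); rewrite -hornerM -rmorphM numE rmorphM hornerM pbE.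
by rewrite -/f bt; ring.
Qed.

Lemma iter_quad_map_onto n b :
  tree_vertex t b -> exists2 c, iter n f c = b & tree_vertex t c.
Proof.
elim: n b => [|n IHn] b [j bt]; first by exists b => //; exists j.
have [b0 _] := iter_quad_map_neq bt.
have [c cE] := exists_quad_map b0.
have [|d dE dt] := IHn c; first by exists j.+1; rewrite iterSr cE.
by exists d => //=; rewrite dE.
Qed.

(** K_N is generated by the vertices of level exactly [N]. A lower vertex is the image under an
    iterate of f of some vertex of level [N] above it, so it lies in K_N too. *)
Lemma splitting_level_vertex N n b :
  (n <= N)%N -> iter n f b = t -> splitting_level iota t N b.
Proof.
move=> le_nN bt.
have [|c cE _] := @iter_quad_map_onto (N - n) b; first by exists n.
rewrite -cE; apply: gen_subfield_iter_quad_map; apply: gen_base; right.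
by apply: root_level_poly; rewrite -(subnKC le_nN) iterD cE.
Qed.

(** * Products of differences [b - 1] and their inverses *)

Definition vertex_upto N (b : Omega) := exists2 n, (n <= N)%N & iter n f b = t.

(** Recording the level bound [N] lets a single induction give both the product formula and
    membership in K_N. *)
Definition vertex_product N (z : Omega) :=
  exists bs bs' : seq Omega,
    [/\ forall b, b \in bs -> vertex_upto N b,
        forall b, b \in bs' -> vertex_upto N b
      & z = \prod_(b <- bs) (b - 1) * \prod_(b <- bs') (b - 1)^-1].

Lemma vertex_product_base N b : vertex_upto N b -> vertex_product N (b - 1).
Proof.
move=> Nb; exists [:: b], [::]; split=> [c|c|] //.
  by rewrite inE => /eqP->.
by rewrite big_seq1 big_nil mulr1.
Qed.

Lemma vertex_product1 N : vertex_product N 1.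
Proof. by exists [::], [::]; rewrite !big_nil mulr1. Qed.

Lemma vertex_productM N x y :
  vertex_product N x -> vertex_product N y -> vertex_product N (x * y).
Proof.
move=> [bs [bs' [Nbs Nbs' ->]]] [cs [cs' [Ncs Ncs' ->]]].
exists (bs ++ cs), (bs' ++ cs'); split=> [b|b|].
- by rewrite mem_cat => /orP[/Nbs | /Ncs].
- by rewrite mem_cat => /orP[/Nbs' | /Ncs'].
by rewrite !big_cat /= mulrACA.
Qed.

Lemma vertex_productV N x : vertex_product N x -> vertex_product N x^-1.
Proof.
move=> [bs [bs' [Nbs Nbs' ->]]]; exists bs', bs; split=> //.
rewrite invfM -!prodfV mulrC; congr (_ * _).
by apply: eq_bigr => b _; rewrite invrK.
Qed.

Lemma vertex_productN1 N : (0 < N)%N -> vertex_product N (-1).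
Proof.
move=> N0; have [t0 _] := @iter_quad_map_neq 0 t erefl.
have [c ct] := exists_quad_map t0.
have c1 : c - 1 != 0 by rewrite quad_map_neq0 // ct.
(* [2 - c] is the other preimage of [t], because [quad_map] depends only on [(x - 1)^2]. *)
have -> : -1 = (c - 1) * (2 - c - 1)^-1.
  have -> : 2 - c - 1 = - (c - 1) by ring.
  by rewrite invrN mulrN divff.
apply/vertex_productM/vertex_productV; apply: vertex_product_base; exists 1%N => //.
rewrite /= /f -ct /quad_map -[in RHS]sqrrN.
by congr (_ / _ ^+ 2); ring.
Qed.

Lemma vertex_product_sqrt_base N b :
  vertex_upto N b -> exists2 s, vertex_product N.+2 s & b - 1 = s ^+ 2.
Proof.
move=> [n le_nN bt].
have [b0 _] := iter_quad_map_neq bt.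
have [c cb] := exists_quad_map b0; set c' := 2 - c.
have c'b : quad_map c' = b.
  by rewrite -cb /quad_map -[in RHS]sqrrN; congr (_ / _ ^+ 2); rewrite /c'; ring.
have ct : iter n.+1 f c = t by rewrite iterSr /f cb.
have c't : iter n.+1 f c' = t by rewrite iterSr /f c'b.
have [c0 _] := iter_quad_map_neq ct; have [c'0 _] := iter_quad_map_neq c't.
have [e ec] := exists_quad_map c0; have [e' ec'] := exists_quad_map c'0.
have et : iter n.+2 f e = t by rewrite iterSr /f ec.
have e't : iter n.+2 f e' = t by rewrite iterSr /f ec'.
exists ((c - 1) * (e - 1) * (e' - 1))^-1.
  apply: vertex_productV; apply: vertex_productM.
    apply: vertex_productM; apply: vertex_product_base.
      by exists n.+1 => //; rewrite ltnS ltnW.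
    by exists n.+2.
  by apply: vertex_product_base; exists n.+2.
have c1 : c - 1 != 0 by rewrite quad_map_neq0 // cb.
have bE : b * (c * c') = b - 1 by rewrite -cb /quad_map /c'; field.
(* Factor by factor, [b], [c], [c'] are the inverse squares of [c - 1], [e - 1], [e' - 1]. *)
rewrite -bE exprVn !exprMn !invfM -mulrA; congr (_ * (_ * _)).
- by rewrite -[LHS]cb /quad_map div1r -invfM.
- by rewrite -[LHS]ec /quad_map div1r -invfM.
by rewrite -[LHS]ec' /quad_map div1r -invfM.
Qed.

(** Having a square root among the products two levels up is stable under products and quotients, so
    the case of a single factor suffices. *)
Lemma vertex_product_sqrt N z :
  vertex_product N z -> exists2 s, vertex_product N.+2 s & z = s ^+ 2.
Proof.
have prod_sqrt bs : (forall b, b \in bs -> vertex_upto N b) ->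
    exists2 s, vertex_product N.+2 s & \prod_(b <- bs) (b - 1) = s ^+ 2.
  move=> Nbs; rewrite big_seq.
  apply: (big_ind (fun x => exists2 s, vertex_product N.+2 s & x = s ^+ 2)).
  - by exists 1; [apply: vertex_product1 | rewrite expr1n].
  - move=> _ _ [r Nr ->] [s Ns ->]; exists (r * s); last by rewrite exprMn.
    exact: vertex_productM.
  - by move=> b /Nbs; apply: vertex_product_sqrt_base.
move=> [bs [bs' [/prod_sqrt[r Nr rE] /prod_sqrt[s Ns sE] ->]]].
exists (r / s); first exact/vertex_productM/vertex_productV.
by rewrite prodfV rE sE expr_div_n.
Qed.

(** Taking all roots of unity of order dividing [2^(m+1)], not just primitive ones, lets the
    induction pass from [z] to [z^2]. The square root obtained for [z^2] is [z] or [-z], and the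
    sign is absorbed because -1 is already a product at level 1. *)
Lemma vertex_product_root1 m z :
  z ^+ (2 ^ m.+1) = 1 -> vertex_product (2 * m).+1 z.
Proof.
elim: m z => [|m IHm] z zE.
  move/eqP: zE; rewrite sqrf_eq1 => /orP[]/eqP->; first exact: vertex_product1.
  exact: vertex_productN1.
have [|s Ns /eqP] := @vertex_product_sqrt (2 * m).+1 (z ^+ 2).
  by apply: IHm; rewrite -exprM -expnS.
rewrite mulnS eqf_sqr => /orP[]/eqP-> //.
by rewrite -mulN1r; apply: vertex_productM => //; apply: vertex_productN1.
Qed.

Lemma splitting_level_vertex_product N z :
  vertex_product N z -> splitting_level iota t N z.
Proof.
have level_sub1 b : vertex_upto N b -> splitting_level iota t N (b - 1).
  move=> [n le_nN bt]; apply: gen_sub; last exact: gen_one.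
  exact: splitting_level_vertex bt.
move=> [bs [bs' [Nbs Nbs' ->]]]; apply: gen_subfieldM; apply: gen_subfield_prod.
  by move=> b /Nbs/level_sub1.
by move=> b /Nbs'/level_sub1/gen_subfieldV.
Qed.

End Tree.

Theorem theorem4p3 (k : fieldExtType rat) (Omega : closedFieldType)
    (iota : {rmorphism k -> Omega}) (t : Omega)
    (t_transc : ~ algebraicOver iota t)
    (m : nat) (m_ge1 : (1 <= m)%N)
    (zeta : Omega) (zeta_prim : (2 ^ m)%N.-primitive_root zeta) :
  (splitting_union iota t zeta /\
   exists bs bs' : seq Omega,
     [/\ forall b, b \in bs -> tree_vertex t b,
         forall b, b \in bs' -> tree_vertex t b
       & zeta = \prod_(b <- bs) (b - 1) * \prod_(b <- bs') (b - 1)^-1])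
  /\ splitting_level iota t (2 * m - 1)%N zeta.
Proof.
have zetaP : vertex_product t (2 * m - 1) zeta.
  case: m m_ge1 zeta_prim => // m _ /prim_expr_order zeta1.
  (* -1 costs one level and each of the remaining square roots costs two, which totals [2m - 1] for
     the original [m]. *)
  have -> : (2 * m.+1 - 1 = (2 * m).+1)%N by rewrite mulnS.
  exact: (vertex_product_root1 t_transc) zeta1.
have zetaK := splitting_level_vertex_product t_transc zetaP.
split=> //; split; first by exists (2 * m - 1)%N.
have [bs [bs' [Nbs Nbs' ->]]] := zetaP.
by exists bs, bs'; split=> // b => [/Nbs | /Nbs'] [n _ bt]; exists n.
Qed.
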